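(* Let $(x_k)_{k\in\mathbb{N}}$ be an (infinite) sequence generated by the IPG-ELS method applied to the problem $\min_{x\in\mathbb{E}} F(x)=f(x)+g(x)$. Then $(x_k)_{k\in\mathbb{N}}$ converges to a point of the solution set $S_*$.
   Context: Setting. $\mathbb{E}$ is a finite-dimensional Euclidean space with inner product $\langle\cdot,\cdot\rangle$ and norm $\|\cdot\|=\sqrt{\langle\cdot,\cdot\rangle}$; $g:\mathbb{E}\to\mathbb{R}\cup\{+\infty\}$ is proper, lower semicontinuous and convex; $f:\mathbb{E}\to\mathbb{R}$ is continuously differentiable and convex (no Lipschitz assumption on $\nabla f$). $F:=f+g$, $F_*$ is the optimal value of $\min_{x\in\mathbb{E}}F(x)$ and $S_*$ its set of minimizers; it is assumed that $S_*\neq\emptyset$. $\mathrm{dom}\,g=\{x: g(x)<+\infty\}$. For $\varepsilon\ge 0$ and $x\in\mathrm{dom}\,g$, $\partial_\varepsilon g(x):=\{v\in\mathbb{E}: g(y)\ge g(x)+\langle v,y-x\rangle-\varepsilon\ \ \forall y\in\mathbb{E}\}$, and $\partial_\varepsilon g(x)=\emptyset$ if $x\notin\mathrm{dom}\,g$. IPG-ELS method (Inexact Proximal Gradient method with an Explicit Linesearch). Parameters: $x_0\in\mathrm{dom}\,g$, $\tau\in(0,1]$, $\theta\in(0,1)$, $\gamma_1>1$, $\gamma_2\ge 1$, $\alpha\in[0,1-\tau]$. Set $k=0$. Step 2: find any triple $(\tilde x_k,v_k,\varepsilon_k)\in\mathbb{E}\times\mathbb{E}\times[0,\infty)$ such that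 $$v_k\in\nabla f(x_k)+\partial_{\varepsilon_k}g(\tilde x_k)+\tilde x_k-x_k,$$ $$g(\tilde x_k-v_k)-g(\tilde x_k)-\langle\nabla f(x_k),v_k\rangle+\tfrac{1+\gamma_1}{2}\|v_k\|^2+(1+\gamma_2)\varepsilon_k\le\tfrac{1-\tau-\alpha}{2}\|x_k-\tilde x_k\|^2.$$ Step 3: if $\tilde x_k=x_k$, stop. Step 4 (linesearch): put $y_k:=\tilde x_k-v_k$ and start with $\beta=1$. If $$f(x_k+\beta(y_k-x_k))\le f(x_k)+\beta\langle\nabla f(x_k),y_k-x_k\rangle+\tfrac{\beta\tau}{2}\|x_k-\tilde x_k\|^2+\tfrac{\gamma_1}{2}\beta\|v_k\|^2+\beta\gamma_2\varepsilon_k,$$ set $\beta_k=\beta$, $x_{k+1}=x_k+\beta_k(y_k-x_k)$, $k:=k+1$ and return to Step 2; otherwise replace $\beta$ by $\theta\beta$ and test the inequality again. *)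

(* Defs.v *)
From HB Require Import structures.
From mathcomp Require Import all_boot all_order all_algebra.
From mathcomp Require Import all_classical all_reals all_analysis.

Set Implicit Arguments.
Unset Strict Implicit.
Unset Printing Implicit Defensive.

Import Order.TTheory GRing.Theory Num.Theory.
Import numFieldNormedType.Exports.

Local Open Scope classical_set_scope.
Local Open Scope ring_scope.

(* Finite dimension comes from [Vector]; the norm, hence the topology, is the
   one induced by the inner product. *)
HB.mixin Record isEuclidean (R : realType) E
    & NormedModule R E & Vector R E := {
  inner : {dot E for (@idfun R)};
  norm_inner : forall x : E, `|x| = Num.sqrt (inner x x)
}.

#[short(type="euclideanType")]
HB.structure Definition Euclidean (R : realType) :=
  {E of NormedModule R E & Vector R E & isEuclidean R E}.

Notation "''<' u , v >" := (inner u v)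
  (at level 0, u, v at level 69, format "''<' u ,  v >") : ring_scope.

Section ConvexAnalysis.
Context {R : realType} {E : euclideanType R}.
Implicit Types (f : E -> R) (g F : E -> \bar R) (gradf : E -> E).

Definition edom g : set E := [set x | (g x < +oo)%E].

Definition eproper g := (forall x, g x != -oo%E) /\ edom g !=set0.

(* Meant for [g] without the value [-oo], so that the sum on the right is never
   [+oo - oo]; note [0 * +oo = 0] in [\bar R]. *)
Definition econvex g := forall (x y : E) (t : R), 0 <= t <= 1 ->
  (g (t *: x + (1 - t) *: y)%R <= t%:E * g x + (1 - t)%:E * g y)%E.

Definition is_gradient f gradf :=
  forall x, differentiable f x /\ forall h, 'd f x h = '<gradf x, h>.

Definition eps_subdiff (eps : R) g (x : E) : set E :=
  [set v | edom g x /\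
           forall y, (g x + '<v, y - x>%:E - eps%:E <= g y)%E].

Definition composite f g : E -> \bar R := fun x => ((f x)%:E + g x)%E.

Definition minimizers F : set E := [set x | forall y, (F x <= F y)%E].

End ConvexAnalysis.

Section IPG_ELS.
Context {R : realType} {E : euclideanType R}.
Variables (f : E -> R) (gradf : E -> E) (g : E -> \bar R).
Variables (tau theta gamma1 gamma2 alpha : R).

Definition ipg_els_params :=
  [/\ 0 < tau <= 1, 0 < theta < 1, 1 < gamma1, 1 <= gamma2
    & 0 <= alpha <= 1 - tau].

(* For proper [g], the inclusion forces [g xt] to be finite, so the subtraction
   [g (xt - v) - g xt] is meaningful. *)
Definition inexact_prox (x xt v : E) (eps : R) :=
  [/\ 0 <= eps,
      (exists2 s, eps_subdiff eps g xt s & v = gradf x + s + xt - x)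
    & (g (xt - v)%R - g xt - '<gradf x, v>%:E
         + ((1 + gamma1) / 2 * `|v| ^+ 2)%:E + ((1 + gamma2) * eps)%:E
       <= ((1 - tau - alpha) / 2 * `|x - xt| ^+ 2)%:E)%E].

Definition linesearch_test (x xt v : E) (eps beta : R) :=
  let y := xt - v in
  f (x + beta *: (y - x)) <=
    f x + beta * '<gradf x, y - x> + beta * tau / 2 * `|x - xt| ^+ 2
      + gamma1 / 2 * beta * `|v| ^+ 2 + beta * gamma2 * eps.

(* Backtracking from [beta = 1] by factors [theta] accepts [theta ^+ j] for the
   first [j] passing the test. *)
Definition linesearch_step (x xt v : E) (eps beta : R) :=
  exists j : nat,
    [/\ beta = theta ^+ j, linesearch_test x xt v eps beta
      & forall i, (i < j)%N -> ~~ linesearch_test x xt v eps (theta ^+ i)].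

(* One full iteration; [xt != x] says that the stopping test fails. *)
Definition ipg_els_iter (x x' : E) :=
  exists (xt v : E) (eps beta : R),
    [/\ inexact_prox x xt v eps, xt != x, linesearch_step x xt v eps beta
      & x' = x + beta *: ((xt - v) - x)].

Definition ipg_els_sequence (x_ : nat -> E) :=
  edom g (x_ 0%N) /\ forall k, ipg_els_iter (x_ k) (x_ k.+1).

End IPG_ELS.

(* Main.v *)
Require Import Defs.
From mathcomp Require Import all_boot all_order all_algebra.
From mathcomp Require Import all_classical all_reals all_analysis.
From mathcomp Require Import ring lra.

Set Implicit Arguments.
Unset Strict Implicit.
Unset Printing Implicit Defensive.

Import Order.TTheory GRing.Theory Num.Theory.
Import numFieldNormedType.Exports.
Local Open Scope classical_set_scope.
Local Open Scope ring_scope.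

(** Write [w = xt - v - x] for the search direction at [x], so that the next
iterate is [x + beta w].  The inclusion defining [v] says that
[x - xt + v - gradf x] is an [eps]-subgradient of [g] at [xt]; together with
the gradient inequality for [f] and the relative error criterion it yields
[inexact_prox_model_bound]: even after adding a nonnegative slack, the
objective with [f] linearised at [x], evaluated at [xt - v], lies below
[F z - <w, x - z> - |w|^2 / 2] for every [z] in the domain of [g].  The
linesearch test absorbs exactly this slack, and convexity of [g] turns the bound
into [linesearch_step_decrease].  Two consequences drive the whole proof:

- for [z = x], the objective decreases by at least [beta / 2 * |w|^2];
- for [z] in the domain of [g], the merit [|x - z|^2 + 2 F x] decreases by at
  least [2 beta (F x - F z)], i.e. the iterates are Fejer monotone with respect to
  every minimizer, up to a telescoping error.

Hence [F (x_ k)] converges to some [L], the iterates are bounded, and by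
compactness they have a cluster point [x].  It is a minimizer
([cluster_point_minimizer]).  If [L] is the optimal value this is lower
semicontinuity.  Otherwise [F (x_ k) - F s] is bounded away from [0] for a
minimizer [s], so the decrease of the merit forces [beta_ k] to [0]; the test
then fails at [beta_ k / theta] for large [k].  A failing test bounds the slack
by the variation of [gradf] along the trial step times [|w|]; the trial step
tends to [0] because [beta^2 |w|^2 <= beta |w|^2] does, so by continuity of
[gradf] alone (no Lipschitz constant) [w], and then [x - xt], [v] and [eps],
vanish along the subsequence.  The [eps]-subgradient inequality passes to the
limit and says that [- gradf x] is a subgradient of [g] at [x].

Finally, the merit with respect to the cluster point [x] converges, hence so
does [|x_ k - x|], whose limit is [0] along a subsequence
([cluster_minimizer_cvg]). *)

(** * The inner product *)

Section InnerProduct.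
Context {R : realType} {E : euclideanType R}.
Implicit Types (x y z : E) (a : R).

Lemma innerC x y : '<x, y> = '<y, x>.
Proof. by rewrite hermitian_subproof /= expr0 mul1r. Qed.

Lemma innerDl x y z : '<x + y, z> = '<x, z> + '<y, z>.
Proof. exact: linearDl. Qed.

Lemma innerZl a x y : '<a *: x, y> = a * '<x, y>.
Proof. exact: linearZl_LR. Qed.

Lemma innerNl x y : '<- x, y> = - '<x, y>.
Proof. by rewrite -scaleN1r innerZl mulN1r. Qed.

Lemma innerDr x y z : '<x, y + z> = '<x, y> + '<x, z>.
Proof. by rewrite ![inner x _]innerC innerDl. Qed.

Lemma innerZr a x y : '<x, a *: y> = a * '<x, y>.
Proof. by rewrite ![inner x _]innerC innerZl. Qed.

Lemma innerNr x y : '<x, - y> = - '<x, y>.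
Proof. by rewrite ![inner x _]innerC innerNl. Qed.

Definition innerE := (innerDl, innerDr, innerZl, innerZr, innerNl, innerNr).

Lemma inner_ge0 x : 0 <= '<x, x>.
Proof.
have [->|x0] := eqVneq x 0; last exact/ltW/neq0_dnorm_gt0.
by rewrite -(scale0r (0 : E)) innerZl mul0r.
Qed.

Lemma normE2 x : `|x| ^+ 2 = '<x, x>.
Proof. by rewrite norm_inner sqr_sqrtr// inner_ge0. Qed.

(** Expand [0 <= |(y, y) x - (x, y) y|^2], which stays division free. *)
Lemma cauchy_schwarz x y : `|'<x, y>| <= `|x| * `|y|.
Proof.
rewrite -ler_sqr ?nnegrE ?mulr_ge0// real_normK ?num_real// exprMn !normE2.
have [->|y0] := eqVneq y 0.
  by rewrite -(scale0r (0 : E)) !innerE !mul0r expr0n mulr0.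
have yy : 0 < '<y, y> by exact: neq0_dnorm_gt0.
have := inner_ge0 ('<y, y> *: x - '<x, y> *: y).
rewrite !innerE (innerC y x) => h.
have {h} : 0 <= '<y, y> * ('<x, x> * '<y, y> - '<x, y> ^+ 2) by lra.
by rewrite pmulr_rge0// subr_ge0.
Qed.

Lemma cvg_inner (u v : E ^nat) (a b : E) : u @ \oo --> a -> v @ \oo --> b ->
  '<u n, v n> @[n --> \oo] --> '<a, b>.
Proof.
move=> ua vb; apply/subr_cvg0.
have bnd0 : `|u n - a| * `|v n| + `|a| * `|v n - b| @[n --> \oo] --> (0 : R).
  have -> : 0 = 0 * `|b| + `|a| * 0 :> R by rewrite mul0r mulr0 addr0.
  apply: cvgD; apply: cvgM; first exact/norm_cvg0P/subr_cvg0.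
  - exact: cvg_norm.
  - exact: cvg_cst.
  - exact/norm_cvg0P/subr_cvg0.
apply: (@squeeze_cvgr _ _ _ _
  (fun n => - (`|u n - a| * `|v n| + `|a| * `|v n - b|))
  (fun n => `|u n - a| * `|v n| + `|a| * `|v n - b|)).
- near=> n; rewrite -ler_norml.
  have -> : '<u n, v n> - '<a, b> = '<u n - a, v n> + '<a, v n - b>.
    by rewrite !innerE; ring.
  by rewrite (le_trans (ler_normD _ _))// lerD// cauchy_schwarz.
- rewrite -[X in _ --> X]oppr0; apply: cvgN; exact: bnd0.
- exact: bnd0.
Unshelve. all: end_near. Qed.

End InnerProduct.

(** * Compactness in finite dimension *)

Section Compactness.
Import VectorInternalTheory.
Context {R : realType} {E : euclideanType R}.

(** Apply the real-valued extraction result to the distances [|x_ n - a|], which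
cluster at [0]. *)
Lemma cluster_subsequence (x_ : E ^nat) (a : E) : cluster (x_ @ \oo) a ->
  exists2 p : nat -> nat, increasing_seq p & (x_ \o p) @ \oo --> a.
Proof.
move=> xa.
have : cluster ((fun n => `|x_ n - a|) @ \oo) 0.
  move=> A B /= xA [e /= e0 eB].
  have xA' : (x_ @ \oo) (x_ @` [set n | A `|x_ n - a|]).
    by apply: filterS xA => n An; exists n.
  have [y [[n /= An <-] ane]] := xa _ _ xA' (nbhsx_ballx a e e0).
  exists `|x_ n - a|; split => //; apply: eB => /=.
  by rewrite sub0r normrN normr_id distrC; move: ane; rewrite -ball_normE.
move=> /cluster_eventually_cvg[p pincr pa]; exists p => //.
by apply/subr_cvg0/norm_cvg0P.
Qed.

Lemma linear_rV_continuous n (h : {linear 'rV[R]_n -> E}) : continuous h.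
Proof.
have -> : (h : 'rV[R]_n -> E) = fun u => \sum_j u 0 j *: h (delta_mx 0 j).
  apply/funext => u; rewrite {1}(row_sum_delta u) linear_sum.
  by apply: eq_bigr => j _; rewrite linearZ.
apply: continuous_big => [|j _ u]; first exact: add_continuous.
exact: (cvgZr_tmp (@coord_continuous R 1 n 0 j u)).
Qed.

(** One half of the equivalence of norms: the norm of [E] is continuous in
coordinates and does not vanish on the compact unit sphere, so it has a positive
minimum there; homogeneity does the rest. *)
Lemma coordinates_bounded :
  exists2 m : R, 0 < m & forall u : 'rV[R]_(dim E), m * `|u| <= `|r2v u : E|.
Proof.
pose S : set 'rV[R]_(dim E) := [set u | `|u| = 1].
have scaleS u : u != 0 -> S (`|u|^-1 *: u).
  move=> u0; rewrite /S /= normrZ normfV normr_id mulVf//.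
  by rewrite normr_eq0.
have [Sne|S0] := pselect (S !=set0); last first.
  (* The sphere is empty exactly in dimension zero, where every [u] is [0]. *)
  exists 1 => // u; have [->|/scaleS Su] := eqVneq u 0.
    by rewrite normr0 mulr0.
  by case: S0; exists (`|u|^-1 *: u).
have Scompact : compact S.
  apply: bounded_closed_compact.
    exists 1; split; first exact: num_real.
    by move=> b b1 u /= ->; exact: ltW.
  rewrite (_ : S = (fun u => `|u|) @^-1` [set 1]); last by apply/seteqP; split.
  apply: closed_comp => [u _|]; first exact: norm_continuous.
  exact: closed_eq.
have [|c /set_mem cS cmin] := @EVT_min_rV R _ (fun u => `|r2v u : E|) S Sne Scompact.
  apply: continuous_subspaceT => u.
  exact: (cvg_norm (@linear_rV_continuous _ r2v u)).
exists `|r2v c : E|.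
  rewrite normr_gt0; apply/eqP => /(congr1 v2r); rewrite r2vK linear0 => c0.
  by move: cS; rewrite /S /= c0 normr0 => /eqP; rewrite eq_sym oner_eq0.
move=> u; have [->|u0] := eqVneq u 0; first by rewrite normr0 mulr0.
have := cmin _ (mem_set (scaleS _ u0)).
by rewrite linearZ normrZ normfV normr_id ler_pdivlMl ?normr_gt0// mulrC.
Qed.

(** The sequence stays in the image, under the continuous coordinate isomorphism,
of a ball of row vectors, and such a ball is compact. *)
Lemma bounded_seq_cluster (x_ : E ^nat) (M : R) : (forall n, `|x_ n| <= M) ->
  exists a, cluster (x_ @ \oo) a.
Proof.
move=> xM; have [m m0 mr] := coordinates_bounded.
pose B : set 'rV[R]_(dim E) := [set u | `|u| <= m^-1 * M].
have Bcompact : compact B.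
  apply: bounded_closed_compact.
    exists (m^-1 * M); split; first exact: num_real.
    by move=> b Mb u /= /le_trans; apply; exact: ltW.
  rewrite (_ : B = (fun u => `|u|) @^-1` [set r : R | r <= m^-1 * M]).
    apply: closed_comp => [u _|]; first exact: norm_continuous.
    exact: closed_le.
  by apply/seteqP; split.
have Kcompact : compact ((r2v : _ -> E) @` B).
  apply: continuous_compact => //; apply: continuous_subspaceT.
  exact: linear_rV_continuous.
have [|a [_ xa]] := Kcompact (x_ @ \oo) _; last by exists a.
apply: (@filterE _ \oo) => n; exists (v2r (x_ n)); last exact: v2rK.
by rewrite /B /= ler_pdivlMl// (le_trans (mr _))// v2rK.
Qed.

End Compactness.

(** * Convex functions *)

Section Convex.
Context {R : realType} {E : euclideanType R}.
Implicit Types (f : E -> R) (g : E -> \bar R) (gradf : E -> E).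

(** The difference quotient of [f] from [x] towards [z] with step [h] in
[(0, 1]] is at most [f z - f x] by convexity; let [h] tend to [0] from the
right. *)
Lemma gradient_inequality f gradf (x z : E) :
  convex_function setT f -> is_gradient f gradf ->
  f x + '<gradf x, z - x> <= f z.
Proof.
move=> fc /(_ x)[df gx].
have dfx : derivable f x (z - x) by exact: diff_derivable.
have fcv : h^-1 *: ((f \o shift x) (h *: (z - x)) - f x) @[h --> 0^'+]
    --> '<gradf x, z - x>.
  by rewrite -gx -deriveE//; exact: cvg_dnbhs_at_right dfx.
rewrite -lerBrDl; apply: (cvgr_to_le fcv).
near=> h.
have h0 : 0 < h by [].
have h1 : h <= 1 by near: h; exact: nbhs_right_le.
have := fc (Itv01 (ltW h0) h1) z x (in_setT _) (in_setT _).
rewrite convRE/= /unstable.onem => fh.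
rewrite [leLHS]/(h^-1 * _) ler_pdivrMl//.
rewrite (_ : h *: (z - x) + x = h *: z + (1 - h) *: x).
  by rewrite lerBlDr (le_trans fh)//; lra.
by rewrite scalerBr scalerBl scale1r addrAC addrA.
Unshelve. all: end_near. Qed.

Lemma fine_edom g x : eproper g -> edom g x -> (fine (g x))%:E = g x.
Proof. by move=> [gNy _] gx; rewrite fineK// fin_numE gNy lt_eqF. Qed.

Lemma fine_econvex g x y (t : R) : eproper g -> econvex g ->
  edom g x -> edom g y -> 0 <= t <= 1 ->
  edom g (t *: x + (1 - t) *: y) /\
  fine (g (t *: x + (1 - t) *: y)) <= t * fine (g x) + (1 - t) * fine (g y).
Proof.
move=> gp gc gx gy t01; have := gc x y t t01.
rewrite -(fine_edom gp gx) -(fine_edom gp gy) -!EFinM -EFinD => le.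
have gxy : edom g (t *: x + (1 - t) *: y) by apply: le_lt_trans le (ltry _).
by split=> //; move: le; rewrite -(fine_edom gp gxy) lee_fin.
Qed.

Lemma lsc_limit_le g (x_ : E ^nat) (c_ : R ^nat) (x : E) (c : R) :
  lower_semicontinuous g -> x_ @ \oo --> x -> c_ @ \oo --> c ->
  (forall n, (g (x_ n) <= (c_ n)%:E)%E) -> (g x <= c%:E)%E.
Proof.
move=> glsc xx cc gc; rewrite leNgt; apply/negP => cg.
have [r /andP[cr rg]] : exists r : R, (c < r) && (r%:E < g x)%E.
  case: (g x) cg => [t|_|//]; last first.
    by exists (c + 1); rewrite ltrDl ltr01 ltry.
  by rewrite lte_fin => /midf_lt[ct tc]; exists ((c + t) / 2); rewrite ct lte_fin.
have [V Vx Vg] := glsc _ _ rg.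
have [n [/Vg gn cn]] : exists n, V (x_ n) /\ c_ n < r.
  apply: (@filter_ex _ \oo); apply: filterI; first exact: xx.
  exact: cvgr_lt cc _ cr.
by move: (lt_le_trans gn (gc n)); rewrite lte_fin ltNge (ltW cn).
Qed.

(** Optimality only has to be compared with the points of the domain of [g], and
the bound on [g x] is stated in the extended reals so that it also proves that
[x] lies in that domain. *)
Lemma minimizer_of_real_bound f g (x : E) : eproper g -> 
  (forall z, edom g z -> (g x <= (f z + fine (g z) - f x)%:E)%E) ->
  minimizers (composite f g) x.
Proof.
move=> gp h z; rewrite /composite.
have [gz|] := pselect (edom g z).
  have := h z gz; rewrite -{2}(fine_edom gp gz) -EFinD.
  have gx : edom g x by apply: le_lt_trans (h z gz) (ltry _).
  by rewrite -(fine_edom gp gx) -EFinD !lee_fin; lra.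
by move=> /negP; rewrite -leNgt leye_eq => /eqP ->; rewrite addey// leey.
Qed.
End Convex.

(** * One iteration *)

Section Step.
Context {R : realType} {E : euclideanType R}.
Variables (f : E -> R) (gradf : E -> E) (g : E -> \bar R).
Variables (tau theta gamma1 gamma2 alpha : R).
Hypotheses (g_proper : eproper g) (g_convex : econvex g).
Hypotheses (f_gradient : is_gradient f gradf).
Hypotheses (f_convex : convex_function setT f).
Hypothesis params : ipg_els_params tau theta gamma1 gamma2 alpha.
Implicit Types (x xt v z : E) (eps beta : R).

Definition objective x := f x + fine (g x).

(** The terms that the acceptance test grants, per unit of stepsize, on top of the
linearisation of [f]. *)
Definition linesearch_slack x xt v eps :=
  tau / 2 * `|x - xt| ^+ 2 + gamma1 / 2 * `|v| ^+ 2 + gamma2 * eps.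

Lemma inexact_prox_eps_subgradient x xt v eps z :
  inexact_prox gradf g tau gamma1 gamma2 alpha x xt v eps -> edom g z ->
  fine (g xt) + '<x - xt + v - gradf x, z - xt> - eps <= fine (g z).
Proof.
move=> [_ [s [gxt sub] ->] _] gz; have := sub z.
rewrite -(fine_edom g_proper gxt) -(fine_edom g_proper gz).
rewrite -!EFinD lee_fin; apply: le_trans.
rewrite (_ : x - xt + _ - _ = s)//.
by rewrite -[_ + xt - x]addrA -(opprB x xt) (addrC (x - xt)) subrK addrAC subrr
  add0r.
Qed.

(** An infinite value of [g] at [xt - v] would make the left-hand side of the
error criterion infinite. *)
Lemma inexact_prox_edom x xt v eps :
  inexact_prox gradf g tau gamma1 gamma2 alpha x xt v eps -> edom g (xt - v).
Proof.
move=> [_ [s [gxt _] _]]; rewrite -(fine_edom g_proper gxt) /edom /=.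
case: g_proper => /(_ (xt - v)); case: (g (xt - v)) => [r|//|//] _ _.
by rewrite ltry.
Qed.

(** Add the error criterion, the [eps]-subgradient inequality at [z] and the
gradient inequality.  With [d = x - xt], one has [w = - (d + v)], and the
polarisation of [<w, d>] makes all quadratic terms collapse to
[- |w|^2 / 2 - alpha / 2 * |d|^2]. *)
Lemma inexact_prox_model_bound x xt v eps z :
  inexact_prox gradf g tau gamma1 gamma2 alpha x xt v eps -> edom g z ->
  f x + fine (g (xt - v)) + '<gradf x, xt - v - x>
    + linesearch_slack x xt v eps
  <= objective z - '<xt - v - x, x - z> - `|xt - v - x| ^+ 2 / 2.
Proof.
move=> ip gz; have sub := inexact_prox_eps_subgradient ip gz.
have gy := inexact_prox_edom ip.
case: ip => eps0 [s [gxt _] _]; rewrite -(fine_edom g_proper gxt).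
rewrite -(fine_edom g_proper gy) -!EFinB -!EFinD lee_fin /objective => crit.
have fz := gradient_inequality x z f_convex f_gradient.
have ad : 0 <= alpha * `|x - xt| ^+ 2.
  by case: params => _ _ _ _ /andP[a0 _]; rewrite mulr_ge0// exprn_ge0.
move: sub crit fz ad; rewrite /linesearch_slack.
have -> : xt - v - x = - (x - xt) - v by rewrite opprB addrAC.
have -> : x - z = x - xt - (z - xt) by rewrite opprB addrA subrK.
have -> : z - x = z - xt - (x - xt) by rewrite opprB addrA subrK.
(* From here on the inequality is linear in the inner products of [d, p, D, v]. *)
move: (x - xt) (z - xt) (gradf x) => d p D.
rewrite !normE2 !innerE (innerC v d).
lra.
Qed.

Lemma linesearch_step_bound x xt v eps beta :
  edom g x -> edom g (xt - v) -> 0 <= beta <= 1 ->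
  linesearch_test f gradf tau gamma1 gamma2 x xt v eps beta ->
  edom g (x + beta *: (xt - v - x)) /\
  objective (x + beta *: (xt - v - x)) <= (1 - beta) * objective x +
    beta * (f x + fine (g (xt - v)) + '<gradf x, xt - v - x>
            + linesearch_slack x xt v eps).
Proof.
move=> gx gy b01; rewrite /linesearch_test /objective /linesearch_slack => test.
have [] := fine_econvex g_proper g_convex gy gx b01.
have <- : x + beta *: (xt - v - x) = beta *: (xt - v) + (1 - beta) *: x.
  by rewrite scalerBr scalerBl scale1r addrCA.
by move=> ? ?; split=> //; lra.
Qed.

(** Convexity bounds the increment [f (x + b w) - f x] by
[b <gradf (x + b w), w>], so a failing test compares the slack with the variation
of the gradient. *)
Lemma linesearch_failure_bound x xt v eps b :
  0 <= eps -> 0 < b ->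
  ~~ linesearch_test f gradf tau gamma1 gamma2 x xt v eps b ->
  linesearch_slack x xt v eps <=
    `|gradf (x + b *: (xt - v - x)) - gradf x| * `|xt - v - x|.
Proof.
move=> eps0 b0; rewrite /linesearch_test -ltNge /linesearch_slack.
set w := xt - v - x => test.
have := gradient_inequality (x + b *: w) x f_convex f_gradient.
rewrite opprD addNKr innerNr innerZr => fx.
apply: le_trans (le_trans (ler_norm _) (cauchy_schwarz _ _)).
by rewrite innerDl innerNl -(ler_pM2l b0); lra.
Qed.

(** Since [tau <= 1 < gamma1], the slack dominates [tau / 2 * (|x - xt|^2 + |v|^2)],
and [w] is, up to sign, the sum of [x - xt] and [v]. *)
Lemma step_le_slack x xt v eps : 0 <= eps ->
  tau / 4 * `|xt - v - x| ^+ 2 <= linesearch_slack x xt v eps.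
Proof.
case: params => /andP[t0 t1] _ g1 g2 _ eps0; rewrite /linesearch_slack.
have ge : 0 <= gamma2 * eps by rewrite mulr_ge0// (le_trans ler01).
have tg : 0 <= (gamma1 - tau) * `|v| ^+ 2.
  by rewrite mulr_ge0 ?exprn_ge0// subr_ge0 (le_trans t1)// ltW.
have := mulr_ge0 (ltW t0) (inner_ge0 (x - xt - v)).
rewrite (_ : xt - v - x = - (x - xt) - v); last by rewrite opprB addrAC.
move: tg ge; move: (x - xt) => d.
rewrite !normE2 !innerE (innerC v d); lra.
Qed.

Lemma linesearch_step_decrease x xt v eps beta z :
  inexact_prox gradf g tau gamma1 gamma2 alpha x xt v eps ->
  edom g x -> edom g z -> 0 <= beta <= 1 ->
  linesearch_test f gradf tau gamma1 gamma2 x xt v eps beta ->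
  objective (x + beta *: (xt - v - x)) <= (1 - beta) * objective x +
    beta * (objective z - '<xt - v - x, x - z> - `|xt - v - x| ^+ 2 / 2).
Proof.
move=> ip gx gz b01 test.
have [_ /le_trans] := linesearch_step_bound gx (inexact_prox_edom ip) b01 test.
apply; rewrite lerD2l ler_wpM2l//; first by case/andP: b01.
exact: inexact_prox_model_bound.
Qed.

(** Take [linesearch_step_decrease] and expand [|x + beta w - z|^2]; the
remainder [- beta (1 - beta) |w|^2] has the right sign because [beta <= 1]. *)
Lemma linesearch_step_fejer x xt v eps beta z :
  inexact_prox gradf g tau gamma1 gamma2 alpha x xt v eps ->
  edom g x -> edom g z -> 0 <= beta <= 1 ->
  linesearch_test f gradf tau gamma1 gamma2 x xt v eps beta ->
  `|x + beta *: (xt - v - x) - z| ^+ 2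
    + 2 * objective (x + beta *: (xt - v - x))
    + 2 * beta * (objective x - objective z)
  <= `|x - z| ^+ 2 + 2 * objective x.
Proof.
move=> ip gx gz b01 test; have := linesearch_step_decrease ip gx gz b01 test.
have : 0 <= beta * (1 - beta) * `|xt - v - x| ^+ 2.
  by case/andP: b01 => b0 b1; rewrite !mulr_ge0 ?exprn_ge0// subr_ge0.
rewrite [x + _ - z]addrAC; move: (objective (x + _)) => F'.
move: (x - z) (xt - v - x) => q w.
by rewrite !normE2 !innerE (innerC q w); lra.
Qed.

Lemma linesearch_step_descent x xt v eps beta :
  inexact_prox gradf g tau gamma1 gamma2 alpha x xt v eps ->
  edom g x -> 0 <= beta <= 1 ->
  linesearch_test f gradf tau gamma1 gamma2 x xt v eps beta ->
  objective (x + beta *: (xt - v - x)) + beta / 2 * `|xt - v - x| ^+ 2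
  <= objective x.
Proof.
move=> ip gx b01 test; have := linesearch_step_decrease ip gx gx b01 test.
by rewrite subrr -(scale0r x) innerZr; lra.
Qed.

Lemma minimizer_real x : minimizers (composite f g) x ->
  edom g x /\ forall z, edom g z -> objective x <= objective z.
Proof.
move=> xmin; case: (g_proper) => gNy [y gy].
have gx : edom g x.
  have := xmin y; rewrite /composite /edom /= -(fine_edom g_proper gy) -EFinD.
  by move: (gNy x); case: (g x) => [r|//|//]; rewrite ltry.
split=> // z gz; have := xmin z; rewrite /composite.
by rewrite -(fine_edom g_proper gx) -(fine_edom g_proper gz) -!EFinD lee_fin.
Qed.

End Step.

(** * Passing to the limit *)

Section Limits.
Context {R : realType} {E : euclideanType R}.

Lemma sqr_norm_cvg0 (u : E ^nat) :
  `|u n| ^+ 2 @[n --> \oo] --> (0 : R) -> u @ \oo --> (0 : E).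
Proof.
move=> u0; apply/norm_cvg0P.
have -> : (fun n => `|u n|) = fun n => Num.sqrt (`|u n| ^+ 2).
  by apply/funext => n; rewrite sqrtr_sqr normr_id.
by rewrite -[X in _ --> X](@sqrtr0 R); apply: continuous_cvg => //;
  exact: sqrt_continuous.
Qed.

Lemma cvg_subsequence (T : topologicalType) (u : T ^nat) (l : T)
    (p : nat -> nat) :
  increasing_seq p -> u @ \oo --> l -> (u \o p) @ \oo --> l.
Proof.
move=> pi ul; apply: (cvg_comp p u _ ul) => A [N _ NA]; exists N => // n /= Nn.
have pn m : (m <= p m)%N.
  elim: m => // m IH; apply: leq_ltn_trans IH _.
  by have := pi m.+1 m; rewrite leEnat ltnn ltnNge => ->.
exact: NA (leq_trans Nn (pn n)).
Qed.

(** This is the step that replaces a Lipschitz gradient: when the trial steps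
[b_ n w] vanish and are rejected, continuity of the gradient makes the slack, and
hence all the errors, vanish; the [eps]-subgradient inequality then passes to the
limit. *)
Lemma failing_linesearch_limit (f : E -> R) (gradf : E -> E) (g : E -> \bar R)
    (tau theta gamma1 gamma2 alpha : R) (x_ xt_ v_ : E ^nat) (eps_ b_ : R ^nat)
    (x : E) :
  eproper g -> lower_semicontinuous g -> is_gradient f gradf ->
  continuous gradf -> convex_function setT f ->
  ipg_els_params tau theta gamma1 gamma2 alpha ->
  (forall n, inexact_prox gradf g tau gamma1 gamma2 alpha
    (x_ n) (xt_ n) (v_ n) (eps_ n)) ->
  (forall n, 0 < b_ n) ->
  (\forall n \near \oo, ~~ linesearch_test f gradf tau gamma1 gamma2
    (x_ n) (xt_ n) (v_ n) (eps_ n) (b_ n)) ->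
  x_ @ \oo --> x ->
  b_ n *: (xt_ n - v_ n - x_ n) @[n --> \oo] --> (0 : E) ->
  minimizers (composite f g) x.
Proof.
move=> gp glsc fg gradc fc params ip b0 fail xx bw0.
have [/andP[t0 _] _ /(lt_trans ltr01) g10 g2 _] := params.
have eps0 n : 0 <= eps_ n by case: (ip n).
pose w n := xt_ n - v_ n - x_ n.
pose D n := `|gradf (x_ n + b_ n *: w n) - gradf (x_ n)|.
pose slack n := linesearch_slack tau gamma1 gamma2 (x_ n) (xt_ n) (v_ n) (eps_ n).
have D0 : D @ \oo --> (0 : R).
  apply/norm_cvg0P; rewrite -(subrr (gradf x)).
  have xbw : x_ n + b_ n *: w n @[n --> \oo] --> x.
    by rewrite -[x]addr0; exact: cvgD.
  exact: (cvgB (continuous_cvg _ (gradc x) xbw) (continuous_cvg _ (gradc x) xx)).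
have failD : \forall n \near \oo, slack n <= D n * `|w n|.
  by apply: filterS fail => n; exact: (linesearch_failure_bound fg fc).
have wD : \forall n \near \oo, `|w n| <= 4 / tau * D n.
  apply: filterS failD => n; rewrite /slack.
  have /le_trans/[apply] :=
    step_le_slack params (x_ n) (xt_ n) (v_ n) (eps0 n).
  rewrite -/(w n) => h.
  have [->|w0] := eqVneq (w n) 0.
    by rewrite normr0 mulr_ge0 ?normr_ge0// divr_ge0// ltW.
  have {}w0 : 0 < `|w n| by rewrite normr_gt0.
  rewrite mulrAC ler_pdivlMr// -(ler_pM2r w0); lra.
have w0 : w @ \oo --> (0 : E).
  apply/norm_cvg0P.
  apply: (@squeeze_cvgr _ _ _ _ (fun=> 0) (fun n => 4 / tau * D n)).
  - by apply: filterS wD => n ->; rewrite normr_ge0.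
  - exact: cvg_cst.
  - by rewrite -(mulr0 (4 / tau)); apply: cvgM => //; exact: cvg_cst.
have sq_ge0 (c : R) (u : E) : 0 < c -> 0 <= c / 2 * `|u| ^+ 2.
  by move=> c0; rewrite mulr_ge0 ?exprn_ge0// divr_ge0// ltW.
have ge_eps n : eps_ n <= gamma2 * eps_ n by rewrite ler_peMl.
have slack_ge n : 0 <= slack n.
  by rewrite !addr_ge0 ?sq_ge0// mulr_ge0// (le_trans ler01).
have slack0 : slack @ \oo --> (0 : R).
  apply: (@squeeze_cvgr _ _ _ _ (fun=> 0) (fun n => D n * `|w n|)).
  - by apply: filterS failD => n ->; rewrite slack_ge.
  - exact: cvg_cst.
  - by rewrite -(mulr0 0); apply: cvgM => //; exact/norm_cvg0P.
have e0 : eps_ @ \oo --> (0 : R).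
  apply: (@squeeze_cvgr _ _ _ _ (fun=> 0) slack) => //; last exact: cvg_cst.
  apply: filterE => n; rewrite eps0 (le_trans (ge_eps n))//.
  by rewrite lerDr addr_ge0 ?sq_ge0.
have d0 : x_ n - xt_ n @[n --> \oo] --> (0 : E).
  apply: sqr_norm_cvg0.
  apply: (@squeeze_cvgr _ _ _ _ (fun=> 0) (fun n => (tau / 2)^-1 * slack n)).
  - apply: filterE => n; rewrite exprn_ge0//= ler_pdivlMl ?divr_gt0//.
    rewrite /slack /linesearch_slack -addrA lerDl.
    by rewrite addr_ge0 ?sq_ge0 ?(le_trans _ (ge_eps n)).
  - exact: cvg_cst.
  - by rewrite -(mulr0 (tau / 2)^-1); apply: cvgM => //; exact: cvg_cst.
have xtx : xt_ @ \oo --> x.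
  rewrite -[x]subr0 (_ : xt_ = fun n => x_ n - (x_ n - xt_ n)); first exact: cvgB.
  by apply/funext => n; rewrite subKr.
have dv0 : x_ n - xt_ n + v_ n @[n --> \oo] --> (0 : E).
  rewrite -[X in _ --> X]oppr0 (_ : (fun n => _) = fun n => - w n).
    exact: cvgN.
  by apply/funext => n; rewrite /w !opprB [LHS]addrAC -addrA.
apply: minimizer_of_real_bound => // z gz.
pose c n := fine (g z) - '<x_ n - xt_ n + v_ n - gradf (x_ n), z - xt_ n> + eps_ n.
have cc : c @ \oo --> fine (g z) - '<0 - gradf x, z - x> + 0.
  apply: cvgD => //; apply: cvgB; first exact: cvg_cst.
  apply: cvg_inner; apply: cvgB => //; last exact: cvg_cst.
  by apply: continuous_cvg => //; exact: gradc.
apply: le_trans (lsc_limit_le glsc xtx cc _) _ => [n|].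
  have := inexact_prox_eps_subgradient gp (ip n) gz.
  case: (ip n) => _ [s [gxt _] _] _.
  by rewrite -(fine_edom gp gxt) lee_fin /c; lra.
rewrite lee_fin sub0r innerNl.
have := gradient_inequality x z fc fg; lra.
Qed.

End Limits.

(** * Convergence of the iterates *)

Section Sequence.
Context {R : realType} {E : euclideanType R}.
Variables (f : E -> R) (gradf : E -> E) (g : E -> \bar R).
Variables (tau theta gamma1 gamma2 alpha : R).
Hypotheses (g_proper : eproper g) (g_lsc : lower_semicontinuous g).
Hypotheses (g_convex : econvex g) (f_gradient : is_gradient f gradf).
Hypotheses (f_C1 : continuous gradf) (f_convex : convex_function setT f).
Hypothesis params : ipg_els_params tau theta gamma1 gamma2 alpha.
Variables (x_ xt_ v_ : E ^nat) (eps_ beta_ : R ^nat).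
Hypothesis x0_dom : edom g (x_ 0%N).
Hypothesis prox : forall k, inexact_prox gradf g tau gamma1 gamma2 alpha
  (x_ k) (xt_ k) (v_ k) (eps_ k).
Hypothesis search : forall k, linesearch_step f gradf tau theta gamma1 gamma2
  (x_ k) (xt_ k) (v_ k) (eps_ k) (beta_ k).
Hypothesis update : forall k,
  x_ k.+1 = x_ k + beta_ k *: (xt_ k - v_ k - x_ k).

Local Notation F := (objective f g).

Lemma stepsize_gt0 k : 0 < beta_ k.
Proof.
by have [_ /andP[th0 _] _ _ _] := params; case: (search k) => j [-> _ _];
  rewrite exprn_gt0.
Qed.

Lemma stepsize_itv01 k : 0 <= beta_ k <= 1.
Proof.
rewrite (ltW (stepsize_gt0 k)) /=.
have [_ /andP[th0 th1] _ _ _] := params; case: (search k) => j [-> _ _].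
by rewrite exprn_ile1 ?ltW.
Qed.

Lemma stepsize_test k : linesearch_test f gradf tau gamma1 gamma2
  (x_ k) (xt_ k) (v_ k) (eps_ k) (beta_ k).
Proof. by case: (search k) => j []. Qed.

(** A stepsize below [1] was reached by backtracking, so its predecessor was
rejected. *)
Lemma stepsize_lt1_failure k : beta_ k < 1 ->
  ~~ linesearch_test f gradf tau gamma1 gamma2
    (x_ k) (xt_ k) (v_ k) (eps_ k) (theta^-1 * beta_ k).
Proof.
have [_ /andP[th0 _] _ _ _] := params.
case: (search k) => -[|j] [-> _ fail]; first by rewrite expr0 ltxx.
by move=> _; rewrite exprS mulKf ?gt_eqF//; exact: fail.
Qed.

Lemma iterates_edom k : edom g (x_ k).
Proof.
elim: k => // k IH; rewrite update.
have := stepsize_test k.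
by case/(linesearch_step_bound g_proper g_convex IH
  (inexact_prox_edom g_proper (prox k)) (stepsize_itv01 k)).
Qed.

Lemma objective_descent k :
  F (x_ k.+1) + beta_ k / 2 * `|xt_ k - v_ k - x_ k| ^+ 2 <= F (x_ k).
Proof.
rewrite update; have := stepsize_test k.
exact: (linesearch_step_descent g_proper g_convex f_gradient f_convex params
  (prox k) (iterates_edom k) (stepsize_itv01 k)).
Qed.

Lemma objective_nonincreasing : nonincreasing_seq (F \o x_).
Proof.
apply/nonincreasing_seqP => k /=; apply: le_trans (objective_descent k).
by rewrite lerDl mulr_ge0 ?exprn_ge0// divr_ge0// ltW ?stepsize_gt0.
Qed.

(** The quantity that is Fejer monotone: the squared distance alone need not
decrease, the objective term makes up for the error. *)
Definition merit z k := `|x_ k - z| ^+ 2 + 2 * F (x_ k).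

Lemma merit_decrease z k : edom g z ->
  merit z k.+1 + 2 * beta_ k * (F (x_ k) - F z) <= merit z k.
Proof.
move=> gz; rewrite /merit update; have := stepsize_test k.
exact: (linesearch_step_fejer g_proper g_convex f_gradient f_convex params
  (prox k) (iterates_edom k) gz (stepsize_itv01 k)).
Qed.

Lemma merit_nonincreasing z : edom g z -> (forall k, F z <= F (x_ k)) ->
  nonincreasing_seq (merit z).
Proof.
move=> gz zmin; apply/nonincreasing_seqP => k.
apply: le_trans (merit_decrease k gz); rewrite lerDl mulr_ge0 ?subr_ge0//.
by rewrite mulr_ge0// ltW ?stepsize_gt0.
Qed.

Section Solvable.
Variable s : E.
Hypotheses (s_dom : edom g s) (s_min : forall z, edom g z -> F s <= F z).

Lemma objective_cvg : cvgn (F \o x_).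
Proof.
apply: nonincreasing_is_cvgn; first exact: objective_nonincreasing.
by exists (F s) => _ [k _ <-]; apply: s_min; exact: iterates_edom.
Qed.

Lemma merit_cvg z : edom g z -> (forall k, F z <= F (x_ k)) -> cvgn (merit z).
Proof.
move=> gz zmin; apply: nonincreasing_is_cvgn; first exact: merit_nonincreasing.
by exists (2 * F z) => _ [k _ <-]; rewrite ler_wpDl ?exprn_ge0// ler_pM2l.
Qed.

Lemma iterates_bounded : exists M, forall k, `|x_ k| <= M.
Proof.
have smin k : F s <= F (x_ k) by apply: s_min; exact: iterates_edom.
exists (`|s| + (1 + (merit s 0 - 2 * F s))) => k.
rewrite -[x_ k](subrK s) addrC (le_trans (ler_normD _ _))// lerD2l.
(* A square bounded by [c] belongs to a number bounded by [1 + c]. *)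
have : `|x_ k - s| ^+ 2 <= merit s 0 - 2 * F s.
  have := merit_nonincreasing s_dom smin (leq0n k).
  by rewrite /merit; have := smin k; lra.
have := sqr_ge0 (`|x_ k - s| - 1); have := sqr_ge0 (`|x_ k - s|); nra.
Qed.

(** The merit decreases by at least [2 beta_ k (L - F s)] and converges. *)
Lemma stepsize_cvg0 : F s < limn (F \o x_) -> beta_ @ \oo --> 0.
Proof.
move=> sL; have smin k : F s <= F (x_ k) by apply: s_min; exact: iterates_edom.
have LF k : limn (F \o x_) <= F (x_ k).
  exact: (nonincreasing_cvgn_ge objective_nonincreasing objective_cvg).
set L := limn _ in sL LF.
have d0 : 0 < 2 * (L - F s) by rewrite mulr_gt0// subr_gt0.
apply: (@squeeze_cvgr _ _ _ _ (fun=> 0)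
  (fun k => (2 * (L - F s))^-1 * (merit s k - merit s k.+1))).
- apply: filterE => k; rewrite (ltW (stepsize_gt0 k)) /= ler_pdivlMl//.
  have := merit_decrease k s_dom.
  have : 0 <= beta_ k * (F (x_ k) - L).
    by rewrite mulr_ge0 ?subr_ge0// ltW ?stepsize_gt0.
  lra.
- exact: cvg_cst.
- rewrite -(mulr0 (2 * (L - F s))^-1) -(subrr (limn (merit s))).
  have mc := merit_cvg s_dom smin.
  by apply: cvgM; [exact: cvg_cst|apply: cvgB => //; rewrite cvg_shiftS].
Qed.

(** Either the objective values reach the optimal value in the limit, or the
stepsizes vanish and the rejected trial steps [beta_ k / theta] are available. *)
Lemma cluster_point_minimizer (p : nat -> nat) (x : E) :
  increasing_seq p -> (x_ \o p) @ \oo --> x -> minimizers (composite f g) x.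
Proof.
move=> pi px; have [th0 th1] : 0 < theta /\ theta < 1.
  by case: params => _ /andP[].
have [sL|Ls] := ltP (F s) (limn (F \o x_)); last first.
  apply: minimizer_of_real_bound => // z gz.
  have fpx : f (x_ (p n)) @[n --> \oo] --> f x.
    apply: (continuous_cvg _ _ px).
    by apply: differentiable_continuous; case: (f_gradient x).
  have Fp := cvg_subsequence pi objective_cvg.
  apply: le_trans (lsc_limit_le g_lsc px (cvgB Fp fpx) _) _ => [n|].
    rewrite /= /objective addrAC subrr add0r.
    by rewrite (fine_edom g_proper (iterates_edom _)).
  by rewrite lee_fin lerB// (le_trans Ls)// s_min.
pose w k := xt_ k - v_ k - x_ k.
have beta0 := stepsize_cvg0 sL.
have bw0 : (theta^-1 * beta_ k) *: w k @[k --> \oo] --> (0 : E).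
  apply: sqr_norm_cvg0.
  pose dF k := F (x_ k) - F (x_ k.+1).
  apply: (@squeeze_cvgr _ _ _ _ (fun=> 0) (fun k => theta^-1 ^+ 2 * (2 * dF k))).
  - apply: filterE => k; rewrite exprn_ge0//= normrZ normrM !exprMn.
    rewrite !real_normK ?num_real// -mulrA ler_wpM2l ?sqr_ge0//.
    have /andP[b0 b1] := stepsize_itv01 k.
    have : 0 <= beta_ k * (1 - beta_ k) * `|w k| ^+ 2.
      by rewrite !mulr_ge0 ?exprn_ge0// subr_ge0.
    by have := objective_descent k; rewrite -/(w k) /dF; lra.
  - exact: cvg_cst.
  - have -> : 0 = theta^-1 ^+ 2 * (2 * (limn (F \o x_) - limn (F \o x_))).
      by rewrite subrr !mulr0.
    do 2 (apply: cvgM; first exact: cvg_cst).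
    have Fc := objective_cvg.
    by apply: cvgB => //; move: Fc; rewrite -(cvg_shiftS (F \o x_)).
apply: (failing_linesearch_limit (x_ := x_ \o p) (xt_ := xt_ \o p)
  (v_ := v_ \o p) (eps_ := eps_ \o p)
  (b_ := fun n => theta^-1 * beta_ (p n)) _ _ f_gradient _ _ params) => //.
- by move=> n; exact: prox.
- by move=> n; rewrite mulr_gt0 ?invr_gt0// stepsize_gt0.
- have : \forall n \near \oo, beta_ (p n) < 1.
    exact: cvgr_lt (cvg_subsequence pi beta0) _ ltr01.
  by apply: filterS => n; exact: stepsize_lt1_failure.
- exact: (cvg_subsequence pi bw0).
Qed.

Lemma cluster_minimizer_cvg (p : nat -> nat) (x : E) : increasing_seq p ->
  (x_ \o p) @ \oo --> x -> edom g x -> (forall k, F x <= F (x_ k)) ->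
  x_ @ \oo --> x.
Proof.
move=> pi px gx xmin; apply/subr_cvg0/sqr_norm_cvg0.
have xc : `|x_ k - x| ^+ 2 @[k --> \oo] -->
    limn (merit x) - 2 * limn (F \o x_).
  rewrite (_ : (fun k => _) = fun k => merit x k - 2 * F (x_ k)); last first.
    by apply/funext => k; rewrite /merit addrK.
  apply: cvgB; first exact: merit_cvg.
  by apply: cvgM; [exact: cvg_cst|exact: objective_cvg].
have xp0 : `|x_ (p n) - x| ^+ 2 @[n --> \oo] --> (0 : R).
  have -> : 0 = `|x - x| * `|x - x| by rewrite subrr normr0 mulr0.
  by apply: cvgM; apply: cvg_norm; apply: cvgB => //; exact: cvg_cst.
by rewrite -(cvg_unique _ (cvg_subsequence pi xc) xp0).
Qed.

End Solvable.
End Sequence.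

Theorem theorem5p1 (R : realType) (E : euclideanType R)
    (f : E -> R) (gradf : E -> E) (g : E -> \bar R)
    (tau theta gamma1 gamma2 alpha : R) (x_ : nat -> E)
    (g_proper : eproper g) (g_lsc : lower_semicontinuous g)
    (g_convex : econvex g)
    (f_gradient : is_gradient f gradf) (f_C1 : continuous gradf)
    (f_convex : convex_function setT f)
    (solvable : minimizers (composite f g) !=set0)
    (params : ipg_els_params tau theta gamma1 gamma2 alpha)
    (generated : ipg_els_sequence f gradf g tau theta gamma1 gamma2 alpha x_) :
  exists2 xstar : E, minimizers (composite f g) xstar & x_ @ \oo --> xstar.
Proof.
have [x0_dom iters] := generated.
pose data k (q : (E * E) * (R * R)) :=
  [/\ inexact_prox gradf g tau gamma1 gamma2 alpha (x_ k) q.1.1 q.1.2 q.2.1,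
      linesearch_step f gradf tau theta gamma1 gamma2
        (x_ k) q.1.1 q.1.2 q.2.1 q.2.2
    & x_ k.+1 = x_ k + q.2.2 *: (q.1.1 - q.1.2 - x_ k)].
have /choice[q qP] : forall k, exists q, data k q.
  move=> k; have [xt [v [eps [b [? _ ? ?]]]]] := iters k.
  by exists (xt, v, (eps, b)).
have prox k := let: And3 h _ _ := qP k in h.
have search k := let: And3 _ h _ := qP k in h.
have update k := let: And3 _ _ h := qP k in h.
have xdom := iterates_edom g_proper g_convex params x0_dom prox search update.
have [s smin] := solvable.
have [s_dom s_le] := minimizer_real g_proper smin.
have [M xM] := iterates_bounded g_proper g_convex f_gradient f_convex params
  x0_dom prox search update s_dom s_le.
have [x /cluster_subsequence[p pi px]] := bounded_seq_cluster xM.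
have xmin : minimizers (composite f g) x.
  exact: (cluster_point_minimizer g_proper g_lsc g_convex f_gradient f_C1
    f_convex params x0_dom prox search update s_dom s_le pi px).
exists x => //; have [x_dom x_le] := minimizer_real g_proper xmin.
exact: (cluster_minimizer_cvg g_proper g_convex f_gradient f_convex params
  x0_dom prox search update s_le pi px x_dom (fun k => x_le _ (xdom k))).
Qed.
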